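(* Let $n\geq 16$ and let $G=G(X,Y)$ be a balanced bipartite graph with parts $X$ and $Y$, $|X|=|Y|=n$ (so $G$ has order $2n$), such that $G$ is 1-tough in the bipartite sense, i.e. $t^{B}(G)\geq 1$. If $\rho(G)\geq\rho(G_{n,n})$, then $G$ contains a Hamilton cycle, unless $G\cong G_{n,n}$.
   Context: All graphs are finite, simple and undirected. The spectral radius $\rho(G)$ of a graph $G$ is the largest eigenvalue of its adjacency matrix. For a graph $G$ and $S\subseteq V(G)$, $G-S$ is obtained by deleting $S$ and all incident edges, and $c(G-S)$ denotes the number of connected components of $G-S$. For a non-complete bipartite graph $G$ with parts $X$ and $Y$, the bipartite toughness is $t^{B}(G)=\min\{|S|/c(G-S)\}$, where the minimum is taken over all proper subsets $S\subset X$ or $S\subset Y$ with $c(G-S)>1$; $G$ is called 1-tough if $t^{B}(G)\geq 1$, i.e. $|S|\geq c(G-S)$ for every proper subset $S$ of $X$ or of $Y$ with $c(G-S)>1$. The graph $G_{n,n}$ is defined as follows: take the complete bipartite graph $K_{n,n-3}$ with parts $\{u_1,\dots,u_n\}$ and $\{v_4,\dots,v_n\}$, add three new vertices $v_1,v_2,v_3$, join each of $v_1,v_2,v_3$ to $u_1$, and join $v_i$ to $u_{i+1}$ for each $1\leq i\leq 3$. Thus $G_{n,n}$ is a balanced bipartite graph with parts $\{u_1,\dots,u_n\}$ and $\{v_1,\dots,v_n\}$. *)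

(* Defs.v *)
From HB Require Import structures.
From mathcomp Require Import all_boot all_order all_algebra.
From mathcomp Require Import classical_sets reals.
Set Implicit Arguments. Unset Strict Implicit. Unset Printing Implicit Defensive.
Import Order.TTheory GRing.Theory Num.Theory.
Local Open Scope ring_scope.

(* A balanced bipartite graph with parts X = {u_1..u_n} and Y = {v_1..v_n}
   is given by its biadjacency relation  b : 'I_n -> 'I_n -> bool,
   b i j = true iff u_(i+1) v_(j+1) is an edge.
   Vertex set: 'I_n + 'I_n, inl i = u_(i+1), inr j = v_(j+1). *)
Definition bvert (n : nat) : finType := ('I_n + 'I_n)%type.

Definition badj (n : nat) (b : 'I_n -> 'I_n -> bool) : rel (bvert n) :=
  fun x y => match x, y with
             | inl i, inr j => b i j
             | inr j, inl i => b i j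
             | _, _ => false
             end.

Definition adjmx (R : realType) (n : nat) (b : 'I_n -> 'I_n -> bool)
  : 'M[R]_(n + n) :=
  let B : 'M[R]_n := \matrix_(i, j) (b i j)%:R in
  block_mx 0 B B^T 0.

(* Spectral radius = largest eigenvalue (the set of eigenvalues of a real
   symmetric matrix is finite and nonempty, so the sup is its maximum). *)
Definition spectral_radius (R : realType) (m : nat) (A : 'M[R]_m) : R :=
  sup [set a : R | eigenvalue A a].

Definition ncomp_del (T : finType) (e : rel T) (S : {set T}) : nat :=
  n_comp [rel x y | [&& e x y, x \notin S & y \notin S]] (~: S).

Definition bip_one_tough (n : nat) (b : 'I_n -> 'I_n -> bool) : Prop :=
  (forall S : {set 'I_n}, S \proper [set: 'I_n] ->
     (1 < ncomp_del (badj b) (inl @: S))%N ->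
     (ncomp_del (badj b) (inl @: S) <= #|S|)%N) /\
  (forall S : {set 'I_n}, S \proper [set: 'I_n] ->
     (1 < ncomp_del (badj b) (inr @: S))%N ->
     (ncomp_del (badj b) (inr @: S) <= #|S|)%N).

Definition hamiltonian (T : finType) (e : rel T) : Prop :=
  exists s : seq T, [/\ uniq s, (forall x, x \in s), (3 <= size s)%N & cycle e s].

Definition graph_iso (T : finType) (e1 e2 : rel T) : Prop :=
  exists f : T -> T, bijective f /\ forall x y, e2 (f x) (f y) = e1 x y.

(* G_{n,n}: K_{n,n-3} on {u_1..u_n} x {v_4..v_n}, plus v_1,v_2,v_3 each
   joined to u_1 and v_i joined to u_(i+1) (i = 1,2,3).  0-indexed:
   j >= 3 adjacent to all i; j < 3 adjacent to i = 0 and i = j+1. *)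
Definition Gnn_b (n : nat) : 'I_n -> 'I_n -> bool :=
  fun i j => (3 <= j)%N || ((j < 3)%N && ((i == 0 :> nat) || (i == j.+1 :> nat))).
Arguments Gnn_b n : clear implicits.

(* Main.v *)
(* Toughness gives the expansion |J| < |N(J)| for nonempty proper subsets J of
   either part: deleting N(J) isolates the vertices of J and leaves a further
   component. If G is not Hamiltonian, enlarge it to an edge-maximal
   non-Hamiltonian graph H; by the crossing argument on a Hamilton path,
   nonadjacent u in X, v in Y satisfy d(u) + d(v) <= n in H. The spectral
   hypothesis gives e(G) >= rho(G)^2 >= rho(G_{n,n})^2 > n (n - 3), so H misses
   fewer than 3n edges. A vertex of codegree d lies on d nonedges whose other
   ends have codegree at least n - d, hence d (n - d) < 3n, and n >= 16 forces
   d <= 3 or d >= n - 3. Counting then shows that all nonedges of H meet three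
   vertices of degree 2 on one side, and their neighbourhoods leave only
   H = G_{n,n}. Finally, comparing an eigenvector of G with a positive
   eigenvector of H shows that a connected proper spanning subgraph of
   G_{n,n} has smaller spectral radius, so G = H. *)

Require Import Defs.
From HB Require Import structures.
From mathcomp Require Import all_boot all_order all_algebra.
From mathcomp Require Import zify ring lra.
From mathcomp Require boolp.
Set Implicit Arguments. Unset Strict Implicit. Unset Printing Implicit Defensive.
Import Order.TTheory GRing.Theory Num.Theory.

(** * Toughness as neighbourhood expansion *)

Lemma badj_sym (n : nat) (b : 'I_n -> 'I_n -> bool) : symmetric (badj b).
Proof. by case=> [i|j] [i'|j']. Qed.

(** Vertices in different components have different component roots, so [root] is injective on
    [D]. *)
Lemma card_independent_le_ncomp (T : finType) (e : rel T) (D : {set T})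
    (a : {pred T}) :
  connect_sym e -> closed e a -> D \subset a ->
  {in D &, forall x y, connect e x y -> x = y} -> (#|D| <= n_comp e a)%N.
Proof.
move=> sym_e cl_a /subsetP sDa indD; rewrite -(@card_in_imset _ _ (fingraph.root e) D).
  apply: subset_leq_card; apply/subsetP => _ /imsetP[x Dx ->].
  by rewrite !inE roots_root //= -(closed_connect cl_a (connect_root e x)) sDa.
by move=> x y Dx Dy rxy; apply: indD => //; apply/(fingraph.rootP sym_e).
Qed.

(** Deleting [S] turns each vertex of [J] into a singleton component, and [z] lies in yet another
    one. *)
Lemma card_isolated_lt_ncomp_del (T : finType) (e : rel T) (S J : {set T}) z :
  symmetric e -> {in J, forall x y, e x y -> y \in S} ->
  {in J, forall x, x \notin S} -> z \notin S -> z \notin J ->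
  (#|J| < ncomp_del e S)%N.
Proof.
move=> sym_e isoJ JS zS zJ; rewrite /ncomp_del.
set e' := [rel x y | _].
have sym_e' : symmetric e' by move=> x y; rewrite /e' /= sym_e; congr (_ && _); rewrite andbC.
have -> : #|J|.+1 = #|z |: J| by rewrite cardsU1 zJ.
have iso : {in J, forall x y, connect e' x y -> x = y}.
  move=> x Jx y /connectP[[|u p] //= /andP[/and3P[exu _ uS] _] _].
  by rewrite (isoJ x) in uS.
have cs : connect_sym e' by exact: sym_connect_sym.
apply: card_independent_le_ncomp => //.
- move=> x y /and3P[_ xS yS]; by rewrite !inE xS yS.
- apply/subsetP => x; rewrite !inE => /orP[/eqP->|/JS] //.
- move=> x y; rewrite !inE => /orP[/eqP->|Jx] /orP[/eqP->|Jy] //.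
  + by rewrite cs => /(iso _ Jy).
  + exact: iso.
  + exact: iso.
Qed.

Definition strong_hall (n : nat) (b : 'I_n -> 'I_n -> bool) : Prop :=
  forall J : {set 'I_n}, J != set0 -> J != setT ->
    (#|J| < #|[set i | [exists j in J, b i j]]|)%N.

(** [fS] and [fJ] stand for the injections of the two parts, in either order, so one argument serves
    both. If N(J) is a whole part the bound is clear; otherwise deleting N(J) isolates [J] while
    some vertex outside [J] survives. *)
Lemma tough_strong_hall (n : nat) (b : 'I_n -> 'I_n -> bool)
    (e : rel (bvert n)) (fS fJ : 'I_n -> bvert n) :
  symmetric e -> injective fJ -> (forall i j, fS i != fJ j) ->
  (forall j u, e (fJ j) u -> exists2 i, b i j & u = fS i) ->
  (forall S : {set 'I_n}, S \proper [set: 'I_n] ->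
     (1 < ncomp_del e (fS @: S))%N -> (ncomp_del e (fS @: S) <= #|S|)%N) ->
  strong_hall b.
Proof.
move=> sym_e injJ disj nbrJ tough J J0 JT; set N := [set i | _].
have [pN|NT] := boolP (N \proper setT); last first.
  have -> : N = setT.
    by apply/eqP; move: NT; rewrite properEneq subsetT andbT negbK.
  by rewrite proper_card // properEneq JT subsetT.
have [z zJ] : exists z, z \notin J.
  by move: JT; rewrite -subTset => /subsetPn[z _ zJ]; exists z.
have notN j : fJ j \notin fS @: N.
  by apply/imsetP => -[i _ fE]; have := disj i j; rewrite fE eqxx.
have lt : (#|J| < ncomp_del e (fS @: N))%N.
  rewrite -(card_imset J injJ).
  apply: (card_isolated_lt_ncomp_del (z := fJ z)) => //.
  - move=> _ /imsetP[j Jj ->] u /nbrJ[i bij ->]; rewrite imset_f // inE.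
    by apply/existsP; exists j; rewrite Jj.
  - by move=> _ /imsetP[j _ ->].
  - by rewrite (mem_imset _ _ injJ).
(* Toughness speaks only of deletions leaving more than one component; [lt] and the nonemptiness of
   [J] ensure this. *)
apply: (leq_trans lt); apply: tough => //; apply: (leq_trans _ lt).
by rewrite ltnS card_gt0.
Qed.

Lemma bip_one_tough_strong_hall (n : nat) (b : 'I_n -> 'I_n -> bool) :
  bip_one_tough b -> strong_hall b /\ strong_hall (fun i j => b j i).
Proof.
case=> tX tY; split.
- apply: (tough_strong_hall (@badj_sym _ b) (@inr_inj _ _) _ _ tX) => //.
  by move=> j [i|//] bij; exists i.
- apply: (tough_strong_hall (@badj_sym _ b) (@inl_inj _ _) _ _ tY) => //.
  by move=> j [//|i] bij; exists i.
Qed.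

(** * Hamilton cycles *)

Definition add_edge (n : nat) (b : 'I_n -> 'I_n -> bool) (x y : 'I_n) :=
  fun i j => b i j || (i == x) && (j == y).

(** The Hamilton cycle must use the new edge xy, and dropping that edge opens it into a path of
    [b]. *)
Lemma hamiltonian_path_of_add_edge (n : nat) (b : 'I_n -> 'I_n -> bool) x y :
  ~ hamiltonian (badj b) -> hamiltonian (badj (add_edge b x y)) ->
  exists p : seq (bvert n),
    [/\ uniq (inl x :: p), forall u, u \in inl x :: p, path (badj b) (inl x) p,
        last (inl x) p = inr y & (3 <= size (inl x :: p))%N].
Proof.
move=> nham [s [us fs s3 cs]].
have diff u v : badj (add_edge b x y) u v -> ~~ badj b u v ->
    (u == inl x) && (v == inr y) || (u == inr y) && (v == inl x).
  by case: u v => [i|j] [i'|j'] //=; rewrite /add_edge => /orP[->//|/andP[/eqP-> /eqP->]] _; rewrite !eqxx ?orbT.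
(* Some step of the cycle is not in [b], hence is the new edge; after reversing the cycle if
   necessary, it runs from y to x. *)
have {s us fs s3 cs} [s [us fs s3 cs syx]] : exists s, [/\ uniq s, forall u, u \in s, (3 <= size s)%N,
    cycle (badj (add_edge b x y)) s & next s (inr y) = inl x].
  have [/forallP all_e|] := boolP [forall u, badj b u (next s u)].
    by case: nham; exists s; split => //; apply: cycle_from_next.
  rewrite negb_forall => /existsP[u].
  have := next_cycle cs (fs u) => /diff /[apply] /orP[] /andP[/eqP uE /eqP nuE]; last first.
    by exists s; split => //; rewrite -uE.
  exists (rev s); split; rewrite ?rev_uniq ?size_rev //.
  - by move=> v; rewrite mem_rev.
  - rewrite rev_cycle; apply: etrans cs; apply: eq_cycle => v w; exact: badj_sym.
  - by rewrite next_rev // -nuE uE prev_next.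
have [k p sE] := rot_to (fs (inl x)).
have uxp : uniq (inl x :: p) by rewrite -sE rot_uniq.
have fxp u : u \in inl x :: p by rewrite -sE mem_rot.
have xp3 : (3 <= size (inl x :: p))%N by rewrite -sE size_rot.
have := cs; rewrite -(rot_cycle k) sE /= rcons_path => /andP[pe' _].
have lp : last (inl x) p = inr y.
  have := prev_next us (inr y); rewrite syx -(prev_rot k us) sE prev_nth mem_head.
  have /memNindex-> : inl x \notin p by case/andP: uxp.
  by rewrite -last_nth.
exists p; split => //.
have {fxp} : p != [::] by case: (p) lp.
case/lastP: p lp uxp xp3 pe' {sE} => [//|q u]; rewrite last_rcons => -> uxp xp3 pe' _.
case: q uxp xp3 pe' => [//|v q] /= /and3P[xq vq uq] _ /andP[xv pv].
(* The first edge does not end at y and the later ones avoid x, so none of them is the added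
   edge. *)
apply/andP; split.
  have : v != inr y by apply: contra vq => /eqP->; rewrite mem_rcons mem_head.
  case: v xv {vq pv xq} => // j; rewrite /badj /add_edge => /orP[//|/andP[_ /eqP->]].
  by rewrite eqxx.
move: pv; apply: (sub_in_path (P := predC1 (inl x))); last first.
  apply/allP => w; rewrite -rcons_cons => wq; rewrite /= /in_mem /=.
  by apply: contraNneq xq => <-.
move=> u1 v1 u1x v1x /diff; case: badj => // /(_ isT) /orP[] /andP[/eqP uE /eqP vE].
  by move: u1x; rewrite /in_mem /= uE eqxx.
by move: v1x; rewrite /in_mem /= vE eqxx.
Qed.

Lemma next_cat (T : eqType) (p1 p2 : seq T) u v :
  uniq (p1 ++ [:: u, v & p2]) -> next (p1 ++ [:: u, v & p2]) u = v.
Proof.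
move=> uc; have := cycle_next uc; rewrite -(rot_cycle (size p1)) rot_size_cat /=.
by case/andP => /eqP.
Qed.

(** Follow the path from x to u, jump to its end, run backwards to v and close up at x. *)
Lemma cycle_cat_rev (T : eqType) (e : rel T) x p1 u v p2 :
  symmetric e -> path e x (p1 ++ [:: u, v & p2]) -> e u (last v p2) -> e x v ->
  cycle e (x :: p1 ++ u :: rev (v :: p2)).
Proof.
move=> esym; rewrite cat_path /= => /and4P[p1e lu _ p2e] uy xv.
rewrite rcons_cat cat_path p1e /= lu /= lastI rev_rcons /= uy /= rcons_path.
rewrite rev_path; apply/andP; split.
  by apply: etrans p2e; apply: eq_path => ? ?; exact: esym.
by case: p2 {uy p2e} => [|w p2] /=; rewrite ?rev_cons ?last_rcons esym.
Qed.

(* On a Hamilton path from x to y, the successor map sends X onto Y. If some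
   u has y as neighbour and its successor has x as neighbour, the path can be
   closed up by reversing the part after u. *)
Lemma nonadjacent_degree_sum (n : nat) (b : 'I_n -> 'I_n -> bool) x y :
  ~ hamiltonian (badj b) -> hamiltonian (badj (add_edge b x y)) -> ~~ b x y ->
  #|[set j | b x j]| + #|[set i | b i y]| <= n.
Proof.
move=> nham hadd nbxy.
have [p [uc fc pe lp c3]] := hamiltonian_path_of_add_edge nham hadd.
set c := inl x :: p in uc fc c3.
have nextP i : exists j p1 p2, c = p1 ++ [:: inl i, inr j & p2].
  case/splitPr cE : {1}c / (fc (inl i)) => [p1 p2].
  case: p2 cE => [|v p2] cE.
    by have := f_equal (last (inl x)) cE; rewrite last_cat /= lp.
  have : sorted (badj b) (drop (size p1) c) by apply: drop_sorted.
  rewrite cE drop_size_cat //= => /andP[].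
  by case: v cE => //= j cE _ _; exists j, p1, p2.
(* The default [i] is never taken: by [nextP] every vertex of X is followed by one of Y. *)
pose f i := if next c (inl i) is inr j then j else i.
have fP i : next c (inl i) = inr (f i).
  have [j [p1 [p2 cE]]] := nextP i; rewrite /f.
  by have -> : next c (inl i) = inr j by rewrite cE next_cat // -cE.
have finj : injective f.
  move=> i i' fii; apply: (@inl_inj _ 'I_n); apply: (can_inj (prev_next uc)).
  by rewrite !fP fii.
(* N(x) has as many elements as its preimage under [f], so it suffices that this preimage and N(y)
   are disjoint subsets of X. *)
rewrite -(card_preimset [set j | b x j] finj) -cardsUI.
rewrite (_ : _ :&: _ = set0).
  by rewrite cards0 addn0 -[X in _ <= X]card_ord max_card.
apply/setP => i; rewrite !inE; apply/negP => /andP[bxf biy].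
have [j [p1 [p2 cE]]] := nextP i.
have jE : j = f i.
  apply: (@inr_inj 'I_n); rewrite -fP cE next_cat // -cE //.
subst j.
case: p1 cE => [|u p1] cE.
  by case: cE => xi _; rewrite xi biy in nbxy.
case: cE => uE pE; subst u.
apply: nham; exists (inl x :: p1 ++ inl i :: rev (inr (f i) :: p2)).
have pm : perm_eq (inl x :: p1 ++ inl i :: rev (inr (f i) :: p2)) c.
  rewrite /c pE perm_cons perm_cat2l perm_cons perm_rev //.
split.
- by rewrite (perm_uniq pm).
- by move=> w; rewrite (perm_mem pm).
- by rewrite (perm_size pm).
- apply: cycle_cat_rev; rewrite -?pE //; first exact: badj_sym.
  by move: lp; rewrite pE last_cat /= => ->.
Qed.

(** A pair holds a vertex of X and its successor in Y; flattening the pairs gives the alternating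
    cycle. *)
Lemma hamiltonian_zip (n : nat) (b : 'I_n -> 'I_n -> bool) (ps : seq ('I_n * 'I_n)) :
  2 <= n -> uniq (unzip1 ps) -> uniq (unzip2 ps) -> size ps = n ->
  cycle (fun p q => b p.1 p.2 && b q.1 p.2) ps -> hamiltonian (badj b).
Proof.
move=> n2 u1 u2 sz cy.
have full (s : seq 'I_n) : uniq s -> size s = n -> forall i, i \in s.
  move=> us ss i; have [||_ ->] := uniq_min_size us (s2 := enum 'I_n).
  - by move=> ? _; rewrite mem_enum.
  - by rewrite size_enum_ord ss.
  - by rewrite mem_enum.
pose flat qs : seq (bvert n) := flatten [seq [:: inl q.1; inr q.2] | q <- qs].
have ffull u : u \in flat ps.
  case: u => [i|j].
  + have /mapP[q qs ->] : i \in unzip1 ps by apply: full => //; rewrite size_map.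
    by apply/flatten_mapP; exists q => //; rewrite inE eqxx.
  + have /mapP[q qs ->] : j \in unzip2 ps by apply: full => //; rewrite size_map.
    by apply/flatten_mapP; exists q => //; rewrite !inE eqxx orbT.
have fsize qs : size (flat qs) = (size qs).*2.
  by elim: qs => //= q qs; rewrite /flat /= => ->; rewrite doubleS.
exists (flat ps); split => //.
(* A list of length 2n that contains all 2n vertices has no repetition. *)
- apply: (leq_size_uniq (enum_uniq (bvert n))) => //.
  by rewrite -cardE card_sum !card_ord fsize sz addnn.
- rewrite fsize sz; lia.
have pathf p q qs : path (fun p q => b p.1 p.2 && b q.1 p.2) p (rcons qs q) ->
    path (badj b) (inl p.1) (rcons (inr p.2 :: flat qs) (inl q.1)).
  elim: qs p => [|r qs IH] p /=; first by rewrite andbT => /andP[-> ->].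
  by case/andP => /andP[-> ->] /IH /=.
by case: ps cy {u1 u2 sz ffull} => //= p ps /pathf.
Qed.

Lemma hamiltonian_tr (n : nat) (b : 'I_n -> 'I_n -> bool) :
  hamiltonian (badj (fun i j => b j i)) -> hamiltonian (badj b).
Proof.
pose sw (u : bvert n) : bvert n := match u with inl i => inr i | inr i => inl i end.
have swK : involutive sw by case.
case=> s [us fs s3 cs]; exists (map sw s); split.
- by rewrite (map_inj_uniq (inv_inj swK)).
- by move=> u; rewrite -(swK u) map_f.
- by rewrite size_map.
- case: s cs {us fs s3} => //= u s; rewrite -map_rcons path_map.
  by apply: sub_path => -[?|?] [?|?].
Qed.

Lemma graph_iso_tr (n : nat) (b : 'I_n -> 'I_n -> bool) (e : rel (bvert n)) :
  graph_iso (badj (fun i j => b j i)) e -> graph_iso (badj b) e.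
Proof.
pose sw (u : bvert n) : bvert n := match u with inl i => inr i | inr i => inl i end.
have swK : involutive sw by case.
case=> f [fbij fE]; exists (f \o sw); split; first exact: bij_comp (inv_bij swK).
by move=> u v; rewrite /= fE; case: u v => [?|?] [?|?].
Qed.

(** Each added edge lowers the number of nonedges, so adding edges without creating a Hamilton cycle
    must stop. *)
Lemma maximal_nonhamiltonian (n : nat) (b : 'I_n -> 'I_n -> bool) :
  ~ hamiltonian (badj b) ->
  exists h : 'I_n -> 'I_n -> bool,
    [/\ forall i j, b i j -> h i j, ~ hamiltonian (badj h) &
        forall x y, ~~ h x y -> hamiltonian (badj (add_edge h x y))].
Proof.
have [k] := ubnP #|[set p : 'I_n * 'I_n | ~~ b p.1 p.2]|.
elim: k b => // k IH b bk nham.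
have [mx|] := boolp.EM (forall x y, ~~ b x y -> hamiltonian (badj (add_edge b x y))).
  by exists b.
move/boolp.existsNP => [x].
move/boolp.existsNP => [y] /boolp.not_implyP[nb nh].
have [|h [bh h1 h2]] := IH (add_edge b x y) _ nh; last first.
  by exists h; split => // i j bij; apply: bh; rewrite /add_edge bij.
move: bk; rewrite ltnS; apply: leq_trans; apply: proper_card; apply/properP; split.
  by apply/subsetP => -[i j]; rewrite !inE /= /add_edge negb_or => /andP[].
by exists (x, y); rewrite !inE //= /add_edge !eqxx orbT.
Qed.

(** * Relabellings, recognition of G_{n,n} and explicit Hamilton cycles *)

Lemma perm_cat_compl (n : nat) (l : seq 'I_n) : uniq l ->
  perm_eq (l ++ [seq x <- enum 'I_n | x \notin l]) (enum 'I_n).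
Proof.
move=> ul; apply: uniq_perm; rewrite ?enum_uniq //; last first.
  by move=> x; rewrite mem_cat mem_filter mem_enum andbT orbN.
rewrite cat_uniq ul filter_uniq ?enum_uniq // andbT; apply/hasPn => x.
by rewrite mem_filter => /andP[].
Qed.

(** Each index is sent to its position in the enumeration that lists [l] first. *)
Lemma ord_relabel (n : nat) (l : seq 'I_n) : uniq l ->
  exists f : 'I_n -> 'I_n, [/\ injective f,
    forall x, x \in l -> f x = index x l :> nat & forall x, x \notin l -> size l <= f x].
Proof.
move=> ul; pose r := [seq x <- enum 'I_n | x \notin l].
have plr : perm_eq (l ++ r) (enum 'I_n) by exact: perm_cat_compl.
have mem_lr x : x \in l ++ r by rewrite (perm_mem plr) mem_enum.
have slr : size (l ++ r) = n by rewrite (perm_size plr) size_enum_ord.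
have lt x : index x (l ++ r) < n by rewrite -[X in _ < X]slr index_mem.
exists (fun x => Ordinal (lt x)); split.
- by move=> x y [] exy; rewrite -(nth_index x (mem_lr x)) exy nth_index.
- by move=> x xl /=; rewrite index_cat xl.
- by move=> x xl /=; rewrite index_cat (negbTE xl) leq_addr.
Qed.

Lemma graph_iso_Gnn (n : nat) (b : 'I_n -> 'I_n -> bool) x0 a1 a2 a3 v1 v2 v3 :
  uniq [:: x0; a1; a2; a3] -> uniq [:: v1; v2; v3] ->
  (forall i, b i v1 = (i == x0) || (i == a1)) ->
  (forall i, b i v2 = (i == x0) || (i == a2)) ->
  (forall i, b i v3 = (i == x0) || (i == a3)) ->
  (forall i j, j \notin [:: v1; v2; v3] -> b i j) ->
  graph_iso (badj b) (badj (Gnn_b n)).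
Proof.
move=> ua uv b1 b2 b3 bg.
have [f [finj fin fout]] := ord_relabel ua.
have [g [ginj gin gout]] := ord_relabel uv.
pose h (u : bvert n) : bvert n := match u with inl i => inl (f i) | inr j => inr (g j) end.
have key i j : Gnn_b n (f i) (g j) = b i j.
  have [jv|jv] := boolP (j \in [:: v1; v2; v3]); last first.
    by rewrite bg // /Gnn_b (gout _ jv).
  have fE x : x \in [:: x0; a1; a2; a3] -> (i == x) = (f i == index x [:: x0; a1; a2; a3] :> nat).
    move=> xa; rewrite -fin //; apply/eqP/eqP => [->//|/val_inj]; exact: finj.
  have f0 := fE x0; have f1 := fE a1; have f2 := fE a2; have f3 := fE a3.
  have gj := gin _ jv.
  move: ua uv; rewrite /= !inE !negb_or -!andbA.
  case/and5P => x1 x2 x3 a12 /and3P[a13 a23 _] /and4P[v12 v13 v23 _].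
  move: jv gj f0 f1 f2 f3 => /=; rewrite !inE !eqxx ?orbT.
  rewrite ?(negbTE x1) ?(negbTE x2) ?(negbTE x3) ?(negbTE a12) ?(negbTE a13) ?(negbTE a23).
  move=> jv gj /(_ isT) f0 /(_ isT) f1 /(_ isT) f2 /(_ isT) f3.
  case/or3P: jv gj => /eqP->.
  + by rewrite eqxx => gj; rewrite b1 f0 f1 /Gnn_b gj.
  + by rewrite eqxx (negbTE v12) => gj; rewrite b2 f0 f2 /Gnn_b gj.
  + by rewrite eqxx (negbTE v13) (negbTE v23) => gj; rewrite b3 f0 f3 /Gnn_b gj.
exists h; split.
  by apply: injF_bij => -[i|j] [i'|j'] //= [] => [/finj|/ginj] ->.
by case=> [i|j] [i'|j'] //=; exact: key.
Qed.

Lemma path_rcons_of_all (T : eqType) (r : rel T) (P : pred T) p s q :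
  (forall u v, P u -> r u v) -> all P (p :: s) -> path r p (rcons s q).
Proof.
move=> Pr; elim: s p => [|u s IH] p /=; first by rewrite !andbT => /Pr.
by case/andP => /Pr-> /IH.
Qed.

Lemma hamiltonian_complete (n : nat) (b : 'I_n -> 'I_n -> bool) :
  2 <= n -> (forall i j, b i j) -> hamiltonian (badj b).
Proof.
move=> n2 bT; pose E := enum 'I_n; apply: (@hamiltonian_zip _ _ (zip E E)) => //.
- by rewrite unzip1_zip // enum_uniq.
- by rewrite unzip2_zip // enum_uniq.
- by rewrite size_zip minnn size_enum_ord.
case: (zip E E) => //= p s; apply: (@path_rcons_of_all _ _ predT) => [u v _|]; first by rewrite !bT.
exact: all_predT.
Qed.

Lemma perm_interleave3 (T : eqType) (v1 v2 v3 y1 y2 y3 : T) (s : seq T) :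
  perm_eq [:: v1, y1, v2, y2, v3, y3 & s] [:: v1, v2, v3, y1, y2, y3 & s].
Proof. by apply/permP => P /=; lia. Qed.

(** The cycle starts a1 v1 a2 y1 a3 v2 a4 y2 a5 v3 a6 y3 with further vertices y1, y2, y3 of Y. Each
    v_k sits between two of its neighbours, and every other vertex of Y fits anywhere. *)
Lemma hamiltonian_three_disjoint (n : nat) (b : 'I_n -> 'I_n -> bool)
    a1 a2 a3 a4 a5 a6 v1 v2 v3 :
  6 <= n -> uniq [:: a1; a2; a3; a4; a5; a6] -> uniq [:: v1; v2; v3] ->
  b a1 v1 -> b a2 v1 -> b a3 v2 -> b a4 v2 -> b a5 v3 -> b a6 v3 ->
  (forall i j, j \notin [:: v1; v2; v3] -> b i j) ->
  hamiltonian (badj b).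
Proof.
move=> n6 ua uv b1 b2 b3 b4 b5 b6 bg.
pose compl (l : seq 'I_n) := [seq x <- enum 'I_n | x \notin l].
have ucompl (l : seq 'I_n) : uniq l -> uniq (l ++ compl l).
  by move=> ul; rewrite (perm_uniq (perm_cat_compl ul)) enum_uniq.
have scompl (l : seq 'I_n) : uniq l -> size (l ++ compl l) = n.
  by move=> ul; rewrite (perm_size (perm_cat_compl ul)) size_enum_ord.
have := ucompl _ ua; have := scompl _ ua; set xs := compl [:: a1; _; _; _; _; _].
have good y : y \in compl [:: v1; v2; v3] -> y \notin [:: v1; v2; v3].
  by rewrite mem_filter => /andP[].
move: good; have := ucompl _ uv; have := scompl _ uv; set ys := compl [:: v1; v2; v3].
(* As n >= 6, at least three vertices of Y remain besides v1, v2, v3. *)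
case: ys => [|y1 [|y2 [|y3 ys]]] sy uy good sx ux.
1-3: by exfalso; move: n6; rewrite -sy.
rewrite /= in sy sx.
have ss : size xs = size ys by have [] := etrans sx (esym sy).
pose ps := zip [:: a1, a2, a3, a4, a5, a6 & xs] [:: v1, y1, v2, y2, v3, y3 & ys].
apply: (@hamiltonian_zip _ _ ps); first by apply: leq_trans n6.
- by rewrite unzip1_zip //= ss.
- rewrite unzip2_zip; last by rewrite /= ss.
  by rewrite (perm_uniq (perm_interleave3 v1 v2 v3 y1 y2 y3 ys)).
- by rewrite size_zip /= ss minnn.
rewrite /ps /= b1 b2 b3 b4 b5 b6 !bg ?good ?inE ?eqxx ?orbT //=.
apply: (@path_rcons_of_all _ _ (fun p => p.2 \notin [:: v1; v2; v3])) => [u v Pu|].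
  by rewrite !bg.
rewrite /= good ?inE ?eqxx ?orbT //=; apply/allP => -[i j] /= /(map_f snd) /=.
by rewrite -/(unzip2 _) unzip2_zip ?ss // => jy; rewrite good // !inE jy !orbT.
Qed.

(** * Graphs with few nonedges *)

Definition tr (n : nat) (b : 'I_n -> 'I_n -> bool) := fun i j => b j i.

Definition codeg (n : nat) (b : 'I_n -> 'I_n -> bool) (i : 'I_n) :=
  #|[set j | ~~ b i j]|.

(** The first condition is d(u) + d(v) <= n for nonadjacent u, v, written with codegrees. Together
    the conditions are invariant under exchanging the parts. *)
Definition few_nonedges (n : nat) (b : 'I_n -> 'I_n -> bool) : Prop :=
  [/\ forall i j, ~~ b i j -> n <= codeg b i + codeg (tr b) j,
      \sum_i codeg b i < 3 * n, strong_hall b & strong_hall (tr b)].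

Lemma codegE (n : nat) (b : 'I_n -> 'I_n -> bool) i : codeg b i = \sum_j ~~ b i j.
Proof. by rewrite /codeg -sum1dep_card big_mkcond; apply: eq_bigr => j _; case: b. Qed.

Lemma sum_codeg_tr (n : nat) (b : 'I_n -> 'I_n -> bool) :
  \sum_i codeg (tr b) i = \sum_i codeg b i.
Proof.
under eq_bigr do rewrite codegE; under [RHS]eq_bigr do rewrite codegE.
by rewrite exchange_big.
Qed.

Lemma few_nonedges_tr (n : nat) (b : 'I_n -> 'I_n -> bool) :
  few_nonedges b -> few_nonedges (tr b).
Proof.
case=> cl few h1 h2; split => //; last by rewrite sum_codeg_tr.
by move=> i j nb; rewrite addnC; apply: cl.
Qed.

Lemma card_nbr (n : nat) (b : 'I_n -> 'I_n -> bool) i :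
  #|[set j | b i j]| + codeg b i = n.
Proof.
rewrite -[RHS]card_ord -(cardsC [set j | b i j]); congr (_ + _).
by rewrite /codeg; congr #|pred_of_set _|; apply/setP => j; rewrite !inE.
Qed.

Lemma codeg_mul_le (n : nat) (b : 'I_n -> 'I_n -> bool) i :
  few_nonedges b -> codeg b i * (n - codeg b i) < 3 * n.
Proof.
case=> cl few _ _; apply: leq_ltn_trans few; rewrite -sum_codeg_tr.
rewrite -sum_nat_const [X in _ <= X](bigID (mem [set j | ~~ b i j])) /=.
apply: leq_trans (leq_addr _ _); apply: leq_sum => j; rewrite inE => /cl; lia.
Qed.

(** If 4 <= d <= n - 4 then d (n - d) >= 4 (n - 4), which is at least 3n exactly when n >= 16. *)
Lemma codeg_le3_or_ge (n : nat) (b : 'I_n -> 'I_n -> bool) i :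
  16 <= n -> few_nonedges b -> codeg b i <= 3 \/ n - 3 <= codeg b i.
Proof. move=> n16 /(codeg_mul_le i) lt; have := card_nbr b i; nia. Qed.

(** For n >= 3 these are the vertices of degree at most 3. *)
Definition low_deg (n : nat) (b : 'I_n -> 'I_n -> bool) :=
  [set i | n - 3 <= codeg b i].

(** Otherwise both codegrees are at most 3, and their sum is below n. *)
Lemma nonedge_low (n : nat) (b : 'I_n -> 'I_n -> bool) i j :
  16 <= n -> few_nonedges b -> ~~ b i j -> i \in low_deg b \/ j \in low_deg (tr b).
Proof.
move=> n16 fb nb; rewrite !inE.
have [di|] := codeg_le3_or_ge i n16 fb; last by left.
have [dj|] := codeg_le3_or_ge j n16 (few_nonedges_tr fb); last by right.
case: fb => /(_ _ _ nb); lia.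
Qed.

(** Four such vertices would account for 4 (n - 3) >= 3n nonedges. *)
Lemma card_low (n : nat) (b : 'I_n -> 'I_n -> bool) :
  16 <= n -> few_nonedges b -> #|low_deg b| <= 3.
Proof.
move=> n16 [_ few _ _].
have : #|low_deg b| * (n - 3) <= \sum_i codeg b i.
  rewrite -sum_nat_const [X in _ <= X](bigID (mem (low_deg b))) /=.
  by apply: leq_trans (leq_addr _ _); apply: leq_sum => j; rewrite inE.
nia.
Qed.

(** Strict expansion of a singleton gives degree at least 2. *)
Lemma codeg_le (n : nat) (b : 'I_n -> 'I_n -> bool) i :
  2 <= n -> strong_hall (tr b) -> codeg b i <= n - 2.
Proof.
move=> n2 h; have := card_nbr b i.
have : 1 < #|[set j | b i j]|; last by lia.
have := h [set i]; rewrite cards1 => hi; apply: leq_trans (hi _ _) _.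
- by apply/set0Pn; exists i; rewrite inE.
- by apply/eqP => E; have := cards1 i; rewrite E cardsT card_ord; lia.
- by apply: subset_leq_card; apply/subsetP => j; rewrite !inE => /existsP[k /andP[/set1P->]].
Qed.

(** Among the at least n - 3 nonneighbours of [i], some [j] is not low, since at most three are. Its
    codegree is at least 2 because that of [i] is at most n - 2, and all nonneighbours of [j] are
    low. *)
Lemma low_gt1 (n : nat) (b : 'I_n -> 'I_n -> bool) i :
  16 <= n -> few_nonedges b -> i \in low_deg b -> 1 < #|low_deg b|.
Proof.
move=> n16 fb ib.
have BY := card_low n16 (few_nonedges_tr fb).
have : ~~ ([set j | ~~ b i j] \subset low_deg (tr b)).
  apply/negP => /subset_leq_card; move: ib; rewrite inE /codeg; lia.
case/subsetPn => j; rewrite inE => nb jB.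
have di : codeg b i <= n - 2 by case: fb => _ _ _ h; apply: codeg_le => //; lia.
have dj : 2 <= codeg (tr b) j by case: fb => /(_ _ _ nb); lia.
apply: leq_trans dj _; apply: subset_leq_card; apply/subsetP => k; rewrite inE => nbk.
by have [//|jB'] := nonedge_low n16 fb nbk; rewrite jB' in jB.
Qed.

(** With p low vertices in X and q in Y, both 2 or 3, there are at least q (n - 3) + p (n - 3 - q)
    nonedges. The minimum, at p = q = 2, is 4n - 16, which is at least 3n for n >= 16. *)
Lemma low_one_side (n : nat) (b : 'I_n -> 'I_n -> bool) :
  16 <= n -> few_nonedges b -> low_deg b = set0 \/ low_deg (tr b) = set0.
Proof.
move=> n16 fb.
have [->|[i iB]] := set_0Vmem (low_deg b); first by left.
have [->|[j jB]] := set_0Vmem (low_deg (tr b)); first by right.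
have X2 := low_gt1 n16 fb iB; have Y2 := low_gt1 n16 (few_nonedges_tr fb) jB.
have X3 := card_low n16 fb; have Y3 := card_low n16 (few_nonedges_tr fb).
have : #|low_deg (tr b)| * (n - 3) + #|low_deg b| * (n - 3 - #|low_deg (tr b)|)
    <= \sum_i codeg b i.
  rewrite -sum_codeg_tr [X in _ <= X](bigID (mem (low_deg (tr b)))) /=.
  apply: leq_add.
    by rewrite -sum_nat_const; apply: leq_sum => k; rewrite inE.
  (* Outside the low columns, each low row still has at least n - 3 - q nonedges. *)
  apply: leq_trans (_ : \sum_(k | k \notin low_deg (tr b)) \sum_(l in low_deg b) ~~ b l k <= _).
    rewrite exchange_big -sum_nat_const; apply: leq_sum => l lB.
    have : codeg b l <= #|low_deg (tr b)| + \sum_(k | k \notin low_deg (tr b)) ~~ b l k.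
      rewrite codegE (bigID (mem (low_deg (tr b)))) /= leq_add2r.
      by rewrite -sum1_card; apply: leq_sum => k _; case: (b l k).
    by rewrite leq_subLR; apply: leq_trans; move: lB; rewrite inE.
  apply: leq_sum => k _; rewrite codegE [X in _ <= X](bigID (mem (low_deg b))) /=.
  exact: leq_addr.
case: fb => _ few _ _.
have := few; nia.
Qed.

(** A low v has degree at least 2 by expansion; once its degree is shown to be less than the number
    of low vertices, itself at most 3, both numbers are forced. *)
Lemma card_low_tr (n : nat) (b : 'I_n -> 'I_n -> bool) :
  16 <= n -> few_nonedges b -> low_deg b = set0 -> low_deg (tr b) != set0 ->
  [/\ #|low_deg (tr b)| = 3,
      forall v, v \in low_deg (tr b) -> #|[set i | b i v]| = 2,
      forall i j, j \notin low_deg (tr b) -> b i j,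
      forall i v, v \in low_deg (tr b) -> ~~ b i v -> 2 <= codeg b i &
      4 <= #|[set i | [exists j in low_deg (tr b), b i j]]|].
Proof.
move=> n16 fb B0 BY0; set BY := low_deg (tr b).
have good i j : j \notin BY -> b i j.
  apply: contraNT => nb; have [] := nonedge_low n16 fb nb => //.
  by rewrite B0 inE.
have BY3 := card_low n16 (few_nonedges_tr fb); rewrite -/BY in BY3.
have sub i : [set j | ~~ b i j] \subset BY.
  by apply/subsetP => j; rewrite inE; apply: contraR => /good.
have hN : #|BY| < #|[set i | [exists j in BY, b i j]]|.
  case: fb => _ _ h _; apply: h => //; apply/eqP => E; move: BY3; rewrite E cardsT card_ord; lia.
have nbr v : #|[set i | b i v]| + codeg (tr b) v = n by exact: (card_nbr (tr b)).
have le v : codeg (tr b) v <= n - 2 by case: fb => _ _ h _; apply: codeg_le => //; lia.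
have cl i v : ~~ b i v -> n <= codeg b i + codeg (tr b) v by case: fb => cl _ _ _ /cl.
have lt v : v \in BY -> #|[set i | b i v]| < #|BY|.
  move=> vB; rewrite ltnNge; apply/negP => ge.
  (* If d(v) >= |BY|, every nonneighbour of [v] has codegree at least |BY| and so misses all of
     [BY]. Then N(BY) lies in N(v), so d(v) > |BY|, while a nonneighbour of codegree |BY| forces
     d(v) <= |BY|. *)
  have full i : ~~ b i v -> [set j | ~~ b i j] = BY.
    move=> nb; apply/eqP; rewrite eqEcard sub /=.
    by rewrite -/(codeg b i); apply: (leq_trans ge); have := cl _ _ nb; have := nbr v; lia.
  have : #|[set i | [exists j in BY, b i j]]| <= #|[set i | b i v]|.
    apply: subset_leq_card; apply/subsetP => i; rewrite !inE => /existsP[j /andP[jB bij]].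
    by apply: contraLR bij => /full/setP/(_ j); rewrite inE jB.
  have [i] : exists i, i \in [set i | ~~ b i v].
    by apply/set0Pn; rewrite -card_gt0; rewrite -/(codeg (tr b) v); move: vB; rewrite inE; lia.
  rewrite inE => nb; have := cl _ _ nb; have := nbr v.
  have -> : codeg b i = #|BY| by rewrite /codeg (full _ nb).
  lia.
have [v vB] := set0Pn _ BY0.
have c3 : #|BY| = 3 by have := lt v vB; have := nbr v; have := le v; lia.
split => //.
- by move=> u uB; have := lt u uB; have := nbr u; have := le u; lia.
- by move=> i u _ /cl; have := le u; lia.
- by move: hN; rewrite c3.
Qed.

(** With a common neighbour of v1, v2, v3, each has one further neighbour, and the graph is G_{n,n}.
    Otherwise their neighbourhoods are pairwise disjoint, and a Hamilton cycle exists. *)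
Lemma nbrs_cases (n : nat) (b : 'I_n -> 'I_n -> bool) v1 v2 v3 :
  6 <= n -> uniq [:: v1; v2; v3] ->
  (forall v, v \in [:: v1; v2; v3] -> #|[set i | b i v]| = 2) ->
  (forall i j, j \notin [:: v1; v2; v3] -> b i j) ->
  (forall i v, v \in [:: v1; v2; v3] -> ~~ b i v -> 2 <= codeg b i) ->
  4 <= #|[set i | [exists j in [:: v1; v2; v3], b i j]]| ->
  hamiltonian (badj b) \/ graph_iso (badj b) (badj (Gnn_b n)).
Proof.
move=> n6 uv deg2 good codeg2 N4.
have v1in : v1 \in [:: v1; v2; v3] by rewrite !inE eqxx.
have v2in : v2 \in [:: v1; v2; v3] by rewrite !inE eqxx orbT.
have v3in : v3 \in [:: v1; v2; v3] by rewrite !inE eqxx !orbT.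
have [/existsP[x0 /and3P[x1 x2 x3]]|nox] := boolP [exists i, [&& b i v1, b i v2 & b i v3]].
  right.
  have nbr v : v \in [:: v1; v2; v3] -> b x0 v -> exists a, forall i, b i v = (i == x0) || (i == a).
    move=> vin x0v; have /cards1P[a aE] : #|[set i | b i v] :\ x0| == 1.
      by have := cardsD1 x0 [set i | b i v]; rewrite deg2 // inE x0v add1n => -[<-].
    exists a => i; move/setP/(_ i): aE; rewrite !inE.
    by case: (eqVneq i x0) => [->|] //=; rewrite x0v.
  have [a1 b1] := nbr _ v1in x1; have [a2 b2] := nbr _ v2in x2; have [a3 b3] := nbr _ v3in x3.
  apply: (graph_iso_Gnn (x0 := x0) (a1 := a1) (a2 := a2) (a3 := a3) _ uv) => //.
  (* Four entries covering a set of at least four elements are distinct. *)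
  apply: (leq_size_uniq (enum_uniq [set i | [exists j in [:: v1; v2; v3], b i j]])).
    move=> i; rewrite mem_enum inE => /existsP[j /andP[]]; rewrite !inE.
    by case/or3P => /eqP->; rewrite ?b1 ?b2 ?b3 => /orP[] /eqP->; rewrite eqxx ?orbT.
  by rewrite -cardE.
left.
have only i v v' : v \in [:: v1; v2; v3] -> v' \in [:: v1; v2; v3] -> b i v -> b i v' -> v = v'.
  move=> vin v'in bv bv'; apply/eqP; apply: contraNT nox => vv'.
  (* A vertex adjacent to two of the three but not to the third would have codegree 1, against
     [codeg2]. *)
  have all_b u : u \in [:: v1; v2; v3] -> b i u.
    move=> uin; apply: contraT => nbu; have := codeg2 _ _ uin nbu.
    suff : codeg b i <= 1 by lia.
    apply: leq_trans (_ : #|[set u]| <= 1); last by rewrite cards1.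
    apply: subset_leq_card; apply/subsetP => w; rewrite !inE => nbw.
    have win : w \in [:: v1; v2; v3] by apply: contraR nbw => /good.
    apply: contraNT nbu => wu; rewrite -(negbK (b i u)); apply/negP => nbu.
    have : size [:: v; v'; u; w] <= size [:: v1; v2; v3].
      apply: uniq_leq_size; last first.
        by move=> t; do 3!(rewrite inE => /predU1P[->//|]); rewrite mem_seq1 => /eqP->.
      have d t t' : b i t -> ~~ b i t' -> t != t' by move=> bt; apply: contraNneq => <-.
      by rewrite /= !inE !negb_or vv' (eq_sym u w) wu !d.
    by [].
  by apply/existsP; exists i; rewrite !all_b.
have nbr v : v \in [:: v1; v2; v3] -> exists p q, [/\ p != q, b p v & b q v].
  move=> vin; have /cards2P[p [q [pq E]]] : #|[set i | b i v]| == 2 by rewrite deg2.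
  exists p, q; split => //.
  - by have := set21 p q; rewrite -E inE.
  - by have := set22 p q; rewrite -E inE.
have [p1 [q1 [pq1 bp1 bq1]]] := nbr _ v1in.
have [p2 [q2 [pq2 bp2 bq2]]] := nbr _ v2in.
have [p3 [q3 [pq3 bp3 bq3]]] := nbr _ v3in.
have [v12 v13 v23] : [/\ v1 != v2, v1 != v3 & v2 != v3].
  by move: uv; rewrite /= !inE negb_or => /and3P[/andP[-> ->] -> _].
apply: (hamiltonian_three_disjoint n6 _ uv bp1 bq1 bp2 bq2 bp3 bq3 good).
have d12 p q : b p v1 -> b q v2 -> p != q.
  move=> bp bq; apply: contraNneq v12 => pq; rewrite -pq in bq; apply/eqP; exact: only bp bq.
have d13 p q : b p v1 -> b q v3 -> p != q.
  move=> bp bq; apply: contraNneq v13 => pq; rewrite -pq in bq; apply/eqP; exact: only bp bq.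
have d23 p q : b p v2 -> b q v3 -> p != q.
  move=> bp bq; apply: contraNneq v23 => pq; rewrite -pq in bq; apply/eqP; exact: only bp bq.
by rewrite /= !inE !negb_or pq1 pq2 pq3 (d12 _ _ bp1 bp2) (d12 _ _ bp1 bq2)
  (d12 _ _ bq1 bp2) (d12 _ _ bq1 bq2) (d13 _ _ bp1 bp3) (d13 _ _ bp1 bq3) (d13
  _ _ bq1 bp3) (d13 _ _ bq1 bq3) (d23 _ _ bp2 bp3) (d23 _ _ bp2 bq3) (d23 _ _
  bq2 bp3) (d23 _ _ bq2 bq3).
Qed.

Lemma few_nonedges_one_side (n : nat) (b : 'I_n -> 'I_n -> bool) :
  16 <= n -> few_nonedges b -> low_deg b = set0 ->
  hamiltonian (badj b) \/ graph_iso (badj b) (badj (Gnn_b n)).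
Proof.
move=> n16 fb B0; have [BY0|BY0] := eqVneq (low_deg (tr b)) set0.
  left; apply: hamiltonian_complete => [|i j]; first by apply: leq_trans n16.
  by apply: contraT => nb; have [] := nonedge_low n16 fb nb; rewrite ?B0 ?BY0 inE.
have [] := card_low_tr n16 fb B0 BY0; set BY := low_deg (tr b).
have memBY j : (j \in BY) = (j \in enum BY) by rewrite mem_enum.
have := enum_uniq BY; rewrite cardE.
case E : (enum BY) memBY => [|v1 [|v2 [|v3 [|? ?]]]] // memBY uv _ deg2 good codeg2 N4.
apply: nbrs_cases uv _ _ _ _.
- by apply: leq_trans n16.
- by move=> v; rewrite -memBY => /deg2.
- by move=> i j; rewrite -memBY => /good.
- by move=> i v; rewrite -memBY => /codeg2; apply.
- apply: leq_trans N4 _; apply: subset_leq_card; apply/subsetP => i; rewrite !inE.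
  by case/existsP => j /andP[jB bij]; apply/existsP; exists j; rewrite -memBY jB.
Qed.

Lemma few_nonedges_hamiltonian_or_Gnn (n : nat) (b : 'I_n -> 'I_n -> bool) :
  16 <= n -> few_nonedges b ->
  hamiltonian (badj b) \/ graph_iso (badj b) (badj (Gnn_b n)).
Proof.
move=> n16 fb; have [B0|B0] := low_one_side n16 fb.
  exact: few_nonedges_one_side.
have [|/hamiltonian_tr|/graph_iso_tr] := few_nonedges_one_side n16 (few_nonedges_tr fb).
- exact: B0.
- by left.
- by right.
Qed.

(** * Embedding into G_{n,n}, and connectedness from expansion *)

Lemma strong_hall_sub (n : nat) (b h : 'I_n -> 'I_n -> bool) :
  (forall i j, b i j -> h i j) -> strong_hall b -> strong_hall h.
Proof.
move=> bh hb J J0 JT; apply: leq_trans (hb J J0 JT) _.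
apply: subset_leq_card; apply/subsetP => i; rewrite !inE => /existsP[j /andP[jJ bij]].
by apply/existsP; exists j; rewrite jJ bh.
Qed.

Lemma nonhamiltonian_subgraph_Gnn (n : nat) (b : 'I_n -> 'I_n -> bool) :
  16 <= n -> strong_hall b -> strong_hall (tr b) -> n * (n - 3) < \sum_i \sum_j b i j ->
  ~ hamiltonian (badj b) ->
  exists2 h : 'I_n -> 'I_n -> bool, (forall i j, b i j -> h i j) &
    graph_iso (badj h) (badj (Gnn_b n)).
Proof.
move=> n16 hb hbt eb nham; have [h [bh nh mx]] := maximal_nonhamiltonian nham.
exists h => //; have [|//|//] := few_nonedges_hamiltonian_or_Gnn n16 (b := h).
split.
- move=> i j nb; have := nonadjacent_degree_sum nh (mx _ _ nb) nb.
  by have := card_nbr h i; have := card_nbr (tr h) j; rewrite /tr; lia.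
(* More than n (n - 3) of the n^2 pairs are edges, so fewer than 3n are nonedges. *)
- have tot : \sum_i codeg h i + \sum_i \sum_j h i j = n * n.
    rewrite -big_split /= -[X in _ = X * _]card_ord -sum_nat_const.
    apply: eq_bigr => i _; rewrite codegE -big_split /= -[RHS]card_ord -sum1_card.
    by apply: eq_bigr => j _; case: (h i j).
  have : \sum_i \sum_j b i j <= \sum_i \sum_j h i j.
    apply: leq_sum => i _; apply: leq_sum => j _.
    by have := bh i j; case: (b i j) => // ->.
  nia.
- exact: strong_hall_sub hb.
- by apply: strong_hall_sub hbt => i j; apply: bh.
Qed.

(** If a closed [Z] met both parts in nonempty proper subsets A and B, expansion would give |A| <
    |B| < |A|. Connectedness takes this form so as to apply to the zero set of an eigenvector. *)
Lemma strong_hall_connected (n : nat) (b : 'I_n -> 'I_n -> bool) (Z : pred (bvert n)) :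
  2 <= n -> strong_hall b -> strong_hall (tr b) ->
  (forall x y, badj b x y -> Z x -> Z y) -> (exists x, Z x) -> forall x, Z x.
Proof.
move=> n2 hb ht cl exZ.
pose A := [set i | Z (inl i)]; pose B := [set j | Z (inr j)].
have nbrY i : exists j, b i j.
  have : 0 < #|[set j | b i j]| by have := card_nbr b i; have := codeg_le i n2 ht; lia.
  by case/card_gt0P => j; rewrite inE; exists j.
have nbrX j : exists i, b i j.
  have : 0 < #|[set i | tr b j i]|.
    by have := card_nbr (tr b) j; have := codeg_le j n2 (hb : strong_hall (tr (tr b))); lia.
  by case/card_gt0P => i; rewrite inE; exists i.
have ltBA : B != set0 -> B != setT -> #|B| < #|A|.
  move=> B0 BT; apply: leq_trans (hb B B0 BT) _; apply: subset_leq_card.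
  apply/subsetP => i; rewrite !inE => /existsP[j /andP[]]; rewrite inE => Zj bij.
  exact: cl Zj.
have ltAB : A != set0 -> A != setT -> #|A| < #|B|.
  move=> A0 AT; apply: leq_trans (ht A A0 AT) _; apply: subset_leq_card.
  apply/subsetP => i; rewrite !inE => /existsP[j /andP[]]; rewrite inE => Zj bij.
  exact: cl Zj.
have A0 : A != set0.
  case: exZ => -[i Zi|j Zj]; first by apply/set0Pn; exists i; rewrite inE.
  by have [i bij] := nbrX j; apply/set0Pn; exists i; rewrite inE; apply: cl Zj.
have B0 : B != set0.
  have [i] := set0Pn _ A0; rewrite inE => Zi; have [j bij] := nbrY i.
  by apply/set0Pn; exists j; rewrite inE; apply: cl Zi.
have TA : B = setT -> A = setT.
  move=> BT; apply/setP => i; rewrite inE in_setT; have [j bij] := nbrY i.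
  by have := in_setT j; rewrite -BT inE; apply: cl.
have TB : A = setT -> B = setT.
  move=> AT; apply/setP => j; rewrite inE in_setT; have [i bij] := nbrX j.
  by have := in_setT i; rewrite -AT inE; apply: cl.
have AT : A = setT.
  apply/eqP/contraT => AT; have BT : B != setT by apply: contra AT => /eqP/TA->.
  by have := ltAB A0 AT; rewrite ltnNge (ltnW (ltBA B0 BT)).
case=> [i|j]; first by have := in_setT i; rewrite -AT inE.
by have := in_setT j; rewrite -(TB AT) inE.
Qed.

(** * Eigenvalues *)

From mathcomp Require Import classical_sets reals.
Local Open Scope ring_scope.

(** The zero function is allowed; nonvanishing is stated separately. *)
Definition eigenfun (R : realType) (T : finType) (e : rel T) (a : R) (w : T -> R) :=
  forall v, \sum_u (e v u)%:R * w u = a * w v.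

Lemma adjmxE (R : realType) (n : nat) (b : 'I_n -> 'I_n -> bool) :
  adjmx R b = block_mx 0 (\matrix_(i, j) (b i j)%:R) (\matrix_(i, j) (b i j)%:R)^T 0.
Proof. by []. Qed.

Lemma eigenvalue_eigenfun (R : realType) (n : nat) (b : 'I_n -> 'I_n -> bool) (a : R) :
  eigenvalue (adjmx R b) a <->
  exists w : bvert n -> R, (exists v, w v != 0) /\ eigenfun (badj b) a w.
Proof.
split.
- case/eigenvalueP => v va v0.
  exists (fun t => match t with inl i => v 0 (lshift n i) | inr j => v 0 (rshift n j) end).
  split.
    move/rV0Pn: v0 => [k vk].
    case: (split_ordP k) => [i|j] kE; first by exists (inl i); rewrite -kE.
    by exists (inr j); rewrite -kE.
  case=> [i|j]; rewrite big_sumType /=.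
  + rewrite big1 ?add0r; last by move=> ? _; rewrite mul0r.
    transitivity ((v *m adjmx R b) 0 (lshift n i)); last by rewrite va mxE.
    rewrite mxE big_split_ord /= [in RHS]big1 ?add0r; last first.
      by move=> k _; rewrite adjmxE block_mxEul mxE mulr0.
    by apply: eq_bigr => j _; rewrite adjmxE block_mxEdl !mxE mulrC.
  + rewrite addrC big1 ?add0r; last by move=> ? _; rewrite mul0r.
    transitivity ((v *m adjmx R b) 0 (rshift n j)); last by rewrite va mxE.
    rewrite mxE big_split_ord /= [in RHS]addrC [in RHS]big1 ?add0r; last first.
      by move=> k _; rewrite adjmxE block_mxEdr mxE mulr0.
    by apply: eq_bigr => i _; rewrite adjmxE block_mxEur !mxE mulrC.
- case=> w [[t wt] we]; apply/eigenvalueP.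
  pose v : 'rV[R]_(n + n) := \row_k w (fintype.split k).
  have vl i : v 0 (lshift n i) = w (inl i) by rewrite mxE (unsplitK (inl i)).
  have vr i : v 0 (rshift n i) = w (inr i) by rewrite mxE (unsplitK (inr i)).
  exists v; last first.
    apply/rV0Pn; case: t wt => i wi; first by exists (lshift n i); rewrite vl.
    by exists (rshift n i); rewrite vr.
  apply/rowP => k; rewrite mxE [RHS]mxE big_split_ord /=.
  case: (split_ordP k) => [i|j] ->.
  + rewrite vl -we big_sumType /= big1 ?add0r; last first.
      by move=> k' _; rewrite adjmxE block_mxEul [X in _ * X]mxE mulr0.
    rewrite [in RHS]big1 ?add0r; last by move=> ? _; rewrite mul0r.
    by apply: eq_bigr => j _; rewrite vr adjmxE block_mxEdl !mxE mulrC.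
  + rewrite vr -we big_sumType /= addrC big1 ?add0r; last first.
      by move=> k' _; rewrite adjmxE block_mxEdr [X in _ * X]mxE mulr0.
    rewrite [in RHS]addrC [in RHS]big1 ?add0r; last by move=> ? _; rewrite mul0r.
    by apply: eq_bigr => i _; rewrite vl adjmxE block_mxEur !mxE mulrC.
Qed.

Lemma roots_seq (R : realType) (p : {poly R}) :
  p != 0 -> exists s : seq R, forall x, root p x -> x \in s.
Proof.
move: {2}(size p) (leqnn (size p)) => k.
elim: k p => [|k IH] p; first by rewrite leqn0 size_poly_eq0 => ->.
move=> pk p0; have [[x px]|nop] := boolp.EM (exists x, root p x); last first.
  by exists [::] => x px; case: nop; exists x.
have /factor_theorem[q pq] := px.
have q0 : q != 0 by apply: contraNneq p0 => q0; rewrite pq q0 mul0r.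
have [|s sP] := IH q _ q0.
  by move: pk; rewrite pq size_Mmonic ?monicXsubC // size_XsubC addn2 ltnS.
exists (x :: s) => y; rewrite pq rootM root_XsubC inE orbC.
by case/orP => [->//|/sP->]; rewrite orbT.
Qed.

Lemma seq_max (R : realType) (x0 : R) (s : seq R) :
  exists2 x, x \in x0 :: s & forall y, y \in x0 :: s -> y <= x.
Proof.
elim: s x0 => [|x1 s IH] x0.
  by exists x0; rewrite ?mem_head // => y; rewrite inE => /eqP->.
have [x xs xm] := IH x1; have [le|/ltW le] := leP x0 x.
- exists x; first by rewrite inE xs orbT.
  by move=> y; rewrite inE => /orP[/eqP->//|/xm].
- exists x0; first by rewrite mem_head.
  by move=> y; rewrite inE => /orP[/eqP->//|/xm/le_trans]; apply.
Qed.

(** Eigenvalues are roots of the characteristic polynomial, hence finite in number; given one of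
    them, the supremum is a maximum. *)
Lemma spectral_radius_max (R : realType) (m : nat) (A : 'M[R]_m) (a : R) :
  eigenvalue A a ->
  eigenvalue A (spectral_radius A) /\ a <= spectral_radius A.
Proof.
move=> Aa; set E := [set x : R | eigenvalue A x]%classic.
have [s sP] := roots_seq (monic_neq0 (char_poly_monic A)).
have [x xs xmax] := seq_max a [seq x <- s | eigenvalue A x].
have Ex : E x by move: xs; rewrite inE mem_filter => /orP[/eqP->//|/andP[]].
have ubE : ubound E x.
  move=> y Ey; apply: xmax; rewrite inE mem_filter [eigenvalue A y]Ey /=.
  by rewrite sP ?orbT // -eigenvalue_root_char.
have -> : spectral_radius A = x.
  apply/eqP; rewrite eq_le; apply/andP; split; first by apply: ge_sup ubE; exists x.
  by apply: ub_le_sup => //; exists x.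
by split => //; apply: ubE.
Qed.

(** * Bounding eigenvalues by edges and comparing with a supergraph *)

Lemma sum_sqr_le (R : realType) (I : finType) (a y : I -> R) :
  (\sum_j a j * y j) ^+ 2 <= (\sum_j a j ^+ 2) * (\sum_j y j ^+ 2).
Proof.
(* Cauchy-Schwarz by the Lagrange identity: this double sum is twice the difference of the two
   sides. *)
have : 0 <= \sum_j \sum_k (a j * y k - a k * y j) ^+ 2.
  by do 2!apply: sumr_ge0 => ? _; apply: sqr_ge0.
have -> : \sum_j \sum_k (a j * y k - a k * y j) ^+ 2 =
  \sum_j \sum_k (a j ^+ 2 * y k ^+ 2) + \sum_j \sum_k (y j ^+ 2 * a k ^+ 2)
  - 2 * \sum_j \sum_k ((a j * y j) * (a k * y k)).
  rewrite mulr_sumr -big_split /= -sumrB; apply: eq_bigr => j _.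
  rewrite mulr_sumr -big_split /= -sumrB; apply: eq_bigr => k _; ring.
have dist (f g : I -> R) : \sum_j \sum_k f j * g k = (\sum_j f j) * (\sum_k g k).
  by rewrite mulr_suml; apply: eq_bigr => j _; rewrite mulr_sumr.
rewrite !dist expr2; set A := \sum_j a j ^+ 2; set Y := \sum_j y j ^+ 2.
lra.
Qed.

(** Cauchy-Schwarz in each eigenvalue equation bounds a^2 times the squared norm on one part by e(G)
    times that on the other; adding both bounds gives the claim. *)
Lemma eigenvalue_sqr_le_edges (R : realType) (n : nat) (b : 'I_n -> 'I_n -> bool) (a : R) :
  eigenvalue (adjmx R b) a -> a ^+ 2 <= (\sum_i \sum_j b i j)%N%:R.
Proof.
case/eigenvalue_eigenfun => w [[v wv] we].
set e := (X in _ <= X%:R).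
pose SX := \sum_i w (inl i) ^+ 2; pose SY := \sum_j w (inr j) ^+ 2.
have sq (c : bool) : (c%:R : R) ^+ 2 = c%:R by case: c; rewrite ?expr1n ?expr0n.
have hX : a ^+ 2 * SX <= e%:R * SY.
  rewrite mulr_sumr natr_sum mulr_suml; apply: ler_sum => i _.
  rewrite -exprMn -we big_sumType /= big1 ?add0r; last by move=> ? _; rewrite mul0r.
  apply: le_trans (sum_sqr_le _ _) _; rewrite ler_wpM2r //.
    by apply: sumr_ge0 => ? _; apply: sqr_ge0.
  by rewrite natr_sum; apply: ler_sum => j _; rewrite sq.
have hY : a ^+ 2 * SY <= e%:R * SX.
  rewrite mulr_sumr /e exchange_big natr_sum mulr_suml; apply: ler_sum => i _.
  rewrite -exprMn -we big_sumType /= addrC big1 ?add0r; last by move=> ? _; rewrite mul0r.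
  apply: le_trans (sum_sqr_le _ _) _; rewrite ler_wpM2r //.
    by apply: sumr_ge0 => ? _; apply: sqr_ge0.
  by rewrite natr_sum; apply: ler_sum => j _; rewrite sq.
have Spos : 0 < SX + SY.
  have -> : SX + SY = \sum_u w u ^+ 2 by rewrite big_sumType.
  rewrite (bigD1 v) //=; apply: ltr_wpDr.
    by apply: sumr_ge0 => ? _; apply: sqr_ge0.
  by rewrite exprn_even_gt0.
rewrite -(ler_pM2r Spos) !mulrDr; lra.
Qed.

(* [|w|] is a subsolution for [g] and [z] a supersolution; pairing the two
   and using the symmetry of [g] forces equality everywhere if [a = l]. *)
Lemma eigenfun_subgraph (R : realType) (T : finType) (g h : rel T) (a l : R) (z w : T -> R) :
  symmetric g -> subrel g h -> (forall v, 0 < z v) ->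
  eigenfun h l z -> eigenfun g a w -> (exists v, w v != 0) ->
  a <= l /\
  (l <= a -> (forall x y, h x y -> ~~ g x y -> w x = 0) /\
             (forall x y, g x y -> w x = 0 -> w y = 0)).
Proof.
move=> gsym gh z0 hz gw [v0 wv0].
pose P v := \sum_u (g v u)%:R * `|w u| - a * `|w v|.
pose Q v := l * z v - \sum_u (g v u)%:R * z u.
have P0 v : 0 <= P v.
  rewrite subr_ge0; apply: le_trans (_ : `|a * w v| <= _).
    by rewrite normrM ler_wpM2r // ler_norm.
  rewrite -gw; apply: le_trans (ler_norm_sum _ _ _) _; apply: ler_sum => u _.
  by rewrite normrM ger0_norm.
have Qt v u : 0 <= ((h v u)%:R - (g v u)%:R) * z u.
  apply: mulr_ge0; last exact: ltW.
  by rewrite subr_ge0 ler_nat; have := @gh v u; case: (g v u) => // ->.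
have QE v : Q v = \sum_u ((h v u)%:R - (g v u)%:R) * z u.
  by rewrite /Q -hz -sumrB; apply: eq_bigr => u _; rewrite mulrBl.
have Q0 v : 0 <= Q v by rewrite QE; apply: sumr_ge0.
have S0 : 0 < \sum_v z v * `|w v|.
  rewrite (bigD1 v0) //=; apply: ltr_wpDr.
    by apply: sumr_ge0 => u _; rewrite mulr_ge0 // ltW.
  by rewrite mulr_gt0 // normr_gt0.
have key : (l - a) * (\sum_v z v * `|w v|) = \sum_v (z v * P v + Q v * `|w v|).
  have sw : \sum_v z v * (\sum_u (g v u)%:R * `|w u|) =
            \sum_v (\sum_u (g v u)%:R * z u) * `|w v|.
    under eq_bigr do rewrite mulr_sumr.
    rewrite exchange_big; apply: eq_bigr => u _; rewrite mulr_suml.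
    by apply: eq_bigr => v _; rewrite gsym; ring.
  rewrite mulr_sumr; apply/eqP; rewrite -subr_eq0 -sumrB.
  rewrite (eq_bigr (fun v => (\sum_u (g v u)%:R * z u) * `|w v| -
      z v * (\sum_u (g v u)%:R * `|w u|))).
    by rewrite sumrB sw subrr.
  by move=> v _; rewrite /P /Q; ring.
have t0 v : 0 <= z v * P v + Q v * `|w v|.
  by rewrite addr_ge0 ?mulr_ge0 // ltW.
split.
  by rewrite -subr_ge0 -(pmulr_lge0 _ S0) key sumr_ge0.
move=> la.
have z_eq v : z v * P v + Q v * `|w v| = 0.
  apply/eqP; rewrite eq_le t0 andbT.
  apply: le_trans (_ : \sum_v (z v * P v + Q v * `|w v|) <= 0).
    by rewrite (bigD1 v) //= lerDl sumr_ge0.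
  by rewrite -key pmulr_lle0 // subr_le0.
have [Pz Qz] : (forall v, P v = 0) /\ (forall v, Q v * `|w v| = 0).
  have h1 v : z v * P v = 0 /\ Q v * `|w v| = 0.
    have := z_eq v; have : 0 <= z v * P v by rewrite mulr_ge0 // ltW.
    have : 0 <= Q v * `|w v| by rewrite mulr_ge0.
    by split; lra.
  split=> v; have [zP //] := h1 v.
  by move/eqP: zP; rewrite mulf_eq0 gt_eqF //= => /eqP.
split=> x y.
(* An edge xy of [h] missing from [g] contributes z y > 0 to [Q x], which forces w x = 0. *)
- move=> hxy gxy; apply/eqP; rewrite -normr_eq0; have /eqP := Qz x; rewrite mulf_eq0.
  case/orP => // /eqP Qx; have : Q x > 0; last by rewrite Qx ltxx.
  rewrite QE (bigD1 y) //=; apply: ltr_wpDr; first exact: sumr_ge0.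
  by rewrite hxy (negbTE gxy) subr0 mul1r.
- move=> gxy wx; apply/eqP; rewrite -normr_eq0; have /eqP := Pz x.
  rewrite /P wx normr0 mulr0 subr0 psumr_eq0; last by move=> u _; apply: mulr_ge0.
  by move/allP/(_ y (mem_index_enum y)); rewrite gxy mul1r.
Qed.

(* The eigenvector is constant on the orbits {u_1}, {u_2,u_3,u_4}, {u_5..u_n},
   {v_1,v_2,v_3}, {v_4..v_n}; eliminating its values from the eigenvalue
   equation leaves (t - n s) (t - 4) = 12 s for t = l^2 and s = n - 3. *)
Lemma Gnn_positive_eigenfun (R : realType) (n : nat) : (4 <= n)%N ->
  exists (l : R) (z : bvert n -> R),
    [/\ 0 < l, (n * (n - 3))%:R < l ^+ 2, forall v, 0 < z v
      & eigenfun (badj (Gnn_b n)) l z].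
Proof.
case: n => [|[|[|[|m]]]] // _.
have -> : (m.+4 - 3 = m.+1)%N by lia.
pose s : R := m.+1%:R; pose N : R := m.+4%:R.
have s1 : 1 <= s by rewrite ler1n.
have Ns : N = s + 3 by rewrite /N /s -natrD addn3.
have N4 : 4 <= N by lra.
(* [D ^+ 2] is the discriminant of the quadratic in t, and [t] below is its larger root; D > N s - 4
   puts it above N s. *)
pose D := Num.sqrt ((N * s - 4) ^+ 2 + 48 * s).
have Nonneg : 0 <= (N * s - 4) ^+ 2 by exact: sqr_ge0.
have D2 : D ^+ 2 = (N * s - 4) ^+ 2 + 48 * s by rewrite sqr_sqrtr //; lra.
have D0 : 0 <= D by exact: sqrtr_ge0.
pose t := (N * s + 4 + D) / 2.
have NsD : N * s - 4 < D.
  have [//|le] := ltP (N * s - 4) D.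
  have : D ^+ 2 <= (N * s - 4) ^+ 2 by rewrite !expr2; apply: ler_pM.
  rewrite D2; lra.
have tns : N * s < t by rewrite /t; lra.
have tq : (t - N * s) * (t - 4) = 12 * s.
  have -> : (t - N * s) * (t - 4) = (D ^+ 2 - (N * s - 4) ^+ 2) / 4 by rewrite /t; field.
  by rewrite D2; field.
have Ns4 : 4 <= N * s by nra.
have t4 : 0 < t - 4 by lra.
pose l := Num.sqrt t.
have l2 : l ^+ 2 = t by rewrite sqr_sqrtr //; lra.
have l0 : 0 < l by rewrite sqrtr_gt0; lra.
(* The values are scaled to clear the denominator t - 4; the quadratic is then just the equation at
   v_4, ..., v_n. *)
pose z (v : bvert m.+4) : R := match v with
  | inl i => s * (t - 4) + (if i == 0%N :> nat then 6 * s
                            else if (i < 4)%N then 2 * s else 0)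
  | inr j => if (j < 3)%N then 2 * s * l else l * (t - 4) end.
exists l, z; split => //.
- by rewrite l2 natrM.
- have st : 0 < s * (t - 4) by rewrite mulr_gt0 //; lra.
  case=> [i|j] /=.
  + by case: ifP => _; [lra|case: ifP => _; lra].
  + by case: ifP => _; rewrite !mulr_gt0 //; lra.
case=> [i|j]; rewrite big_sumType /=.
- rewrite big1 ?add0r; last by move=> ? _; rewrite mul0r.
  do 3!rewrite big_ord_recl.
  rewrite (eq_bigr (fun=> l * (t - 4))); last first.
    by move=> k _; rewrite /Gnn_b /= mul1r.
  rewrite sumr_const card_ord -(mulr_natl _ m.+1).
  case: i => [[|[|[|[|i]]]] Hi]; rewrite /Gnn_b /= /bump /=; rewrite -/s; ring.
- rewrite [X in _ + X]big1 ?addr0; last by move=> ? _; rewrite mul0r.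
  do 4!rewrite big_ord_recl.
  case: j => [[|[|[|j]]] Hj]; rewrite /Gnn_b /= /bump /=.
  1-3: rewrite big1 => [|k _]; last by rewrite mul0r.
  1-3: have -> : l * (2 * s * l) = 2 * s * l ^+ 2 by ring.
  1-3: by rewrite l2; ring.
  rewrite (eq_bigr (fun=> s * (t - 4))); last by move=> k _; rewrite mul1r addr0.
  rewrite sumr_const card_ord -(mulr_natl _ m).
  have -> : l * (l * (t - 4)) = l ^+ 2 * (t - 4) by ring.
  have -> : m%:R = N - 4 by rewrite /N -[m.+4]addn4 natrD addrK.
  by rewrite l2; lra.
Qed.

Lemma eigenfun_iso (R : realType) (T : finType) (e1 e2 : rel T) (f : T -> T) (l : R) (z : T -> R) :
  bijective f -> (forall x y, e2 (f x) (f y) = e1 x y) ->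
  eigenfun e2 l z -> eigenfun e1 l (z \o f).
Proof.
move=> fbij fE ez v; rewrite /= -ez [RHS](reindex f); last exact: onW_bij.
by apply: eq_bigr => u _; rewrite fE.
Qed.

(** * Combining the embedding with the spectral comparison *)

Theorem theorem1p3 (R : realType) (n : nat) (b : 'I_n -> 'I_n -> bool) :
  (16 <= n)%N ->
  bip_one_tough b ->
  spectral_radius (adjmx R (Gnn_b n)) <= spectral_radius (adjmx R b) ->
  ~ graph_iso (badj b) (badj (Gnn_b n)) ->
  hamiltonian (badj b).
Proof.
move=> n16 /bip_one_tough_strong_hall[hb ht] rho niso; apply: boolp.contrapT => nham.
have [l [z [l0 l2 z0 ez]]] := @Gnn_positive_eigenfun R n (leq_trans (isT : 4 <= 16)%N n16).
have n0 : (0 < n)%N by apply: leq_trans n16.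
have Gl : eigenvalue (adjmx R (Gnn_b n)) l.
  apply/eigenvalue_eigenfun; exists z; split => //.
  by exists (inl (Ordinal n0)); rewrite gt_eqF.
have [_ lG] := spectral_radius_max Gl; have {lG rho} lrho := le_trans lG rho.
set a := spectral_radius _ in lrho.
have ba : eigenvalue (adjmx R b) a.
  (* Without eigenvalues [a] would be the supremum of the empty set, which is 0 by convention,
     against 0 < l <= a. *)
  have [[c /spectral_radius_max[]//]|none] :=
    boolp.EM (exists c, eigenvalue (adjmx R b) c).
  have : a = 0; last by move=> a0; move: (lt_le_trans l0 lrho); rewrite a0 ltxx.
  rewrite /a /spectral_radius -[RHS](sup0 R); congr sup; apply/seteqP; split => // c bc.
  by case: none; exists c.
have edges : (n * (n - 3) < \sum_i \sum_j b i j)%N.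
  rewrite -(ltr_nat R); apply: lt_le_trans l2 _.
  apply: le_trans (eigenvalue_sqr_le_edges ba).
  by rewrite ler_sqr ?nnegrE // ltW // (lt_le_trans l0).
have [h bh [f [fbij fE]]] := nonhamiltonian_subgraph_Gnn n16 hb ht edges nham.
have /eigenvalue_eigenfun[w [w0 ew]] := ba.
have sub : subrel (badj b) (badj h) by case=> [i|j] [i'|j'] //=; apply: bh.
have [_ /(_ lrho)[w_new w_cl]] := eigenfun_subgraph (@badj_sym _ b) sub (fun v => z0 (f v))
  (eigenfun_iso fbij fE ez) ew w0.
have [hE|] := boolp.EM (forall x y, badj h x y -> badj b x y).
  apply: niso; exists f; split => // x y; rewrite fE.
  by apply/idP/idP => [/hE|/sub].
(* An edge of H missing from G makes [w] vanish at its end x; zeros spread along edges of G, so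
   connectedness gives w = 0. *)
move/boolp.existsNP => [x] /boolp.existsNP[y] /boolp.not_implyP[hxy nbxy].
case: w0 => v /negP; apply.
apply: (@strong_hall_connected _ b (fun u => w u == 0)) => //; first by apply: leq_trans n16.
- by move=> u u' bu /eqP wu; apply/eqP; apply: w_cl bu wu.
- by exists x; apply/eqP; apply: w_new hxy _; apply/negP.
Qed.
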